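(* Let $\kappa>0$ be a cardinal and let $\mathcal F$ be a compact-dominating function system on a Tychonoff space $X$. Then the following conditions are equivalent: (1) $\mathcal F$ is Krasnoselskiĭ contracting with respect to some admissible multimetric $\mathcal D$ on $X$ of cardinality $|\mathcal D|\le\kappa$; (2) $\mathcal F$ is Matkowski contracting with respect to some admissible multimetric $\mathcal D$ on $X$ of cardinality $|\mathcal D|\le\kappa$; (3) $\mathcal F$ is eventually contracting with respect to some admissible multimetric $\mathcal D$ on $X$ of cardinality $|\mathcal D|\le\kappa$. Likewise, the three conditions obtained from (1), (2), (3) by replacing ''admissible multimetric'' everywhere by ''sequentially complete admissible multimetric'' are equivalent to each other.
   Context: All spaces are non-empty. A multimetric on a set $X$ is a family $\mathcal D$ of pseudometrics on $X$ such that for any distinct $x,y\in X$ there is $d\in\mathcal D$ with $d(x,y)>0$. Its canonical topology is the smallest topology on $X$ in which all $d\in\mathcal D$ are continuous. A multimetric $\mathcal D$ on a topological space $X$ is admissible if its canonical topology is the topology of $X$. A sequence in $X$ is $\mathcal D$-Cauchy if it is $d$-Cauchy for every $d\in\mathcal D$; $\mathcal D$ is sequentially complete if every $\mathcal D$-Cauchy sequence converges in $X$. A function system on $X$ is a non-empty finite family $\mathcal F$ of continuous maps $X\to X$. Put $\mathcal F^0=\{\mathrm{id}_X\}$, $\mathcal F^{n+1}=\{f\circ g: f\in\mathcal F,\ g\in\mathcal F^n\}$, and $\mathcal F(A)=\bigcup_{f\in\mathcal F}f(A)$ for $A\subset X$. $\mathcal F$ is compact-dominating if each compact $C\subset X$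 is contained in a compact $K\subset X$ with $\mathcal F(K)\subset K$. For a pseudometric $d$ and a family $\mathcal G$ of self-maps of $X$, $d\omega_{\mathcal G}:[0,\infty]\to[0,\infty]$ is defined by $d\omega_{\mathcal G}(t)=\sup\{d(g(x),g(y)): g\in\mathcal G,\ x,y\in X,\ d(x,y)\le t\}$; $d\omega_{\mathcal F}^n$ denotes the $n$-th iterate of the function $d\omega_{\mathcal F}$, while $d\omega_{\mathcal F^n}$ is the function corresponding to the family $\mathcal F^n$. With respect to $\mathcal D$, the system $\mathcal F$ is - Krasnoselskiĭ contracting if $\sup_{a\le t\le b}d\omega_{\mathcal F}(t)/t<1$ for every $d\in\mathcal D$ and all $0<a<b<\infty$; - Matkowski contracting if $\lim_{n\to\infty}d\omega_{\mathcal F}^n(t)=0$ for every $d\in\mathcal D$ and every real $t>0$; - eventually contracting if $\lim_{n\to\infty}d\omega_{\mathcal F^n}(t)=0$ for every $d\in\mathcal D$ and every real $t>0$. *)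

(* Defs.v *)
From HB Require Import structures.
From mathcomp Require Import all_boot all_order all_algebra.
From mathcomp Require Import all_classical all_reals all_analysis.
Import Order.TTheory GRing.Theory Num.Theory.
Import numFieldNormedType.Exports.

Set Implicit Arguments.
Unset Strict Implicit.
Unset Printing Implicit Defensive.

Local Open Scope classical_set_scope.
Local Open Scope ring_scope.

Section Multimetrics.
Context {R : realType}.

Definition pseudometric (X : Type) (d : X -> X -> R) : Prop :=
  [/\ forall x y, 0 <= d x y,
      forall x, d x x = 0,
      forall x y, d x y = d y x
    & forall x y z, d x z <= d x y + d y z].

Definition multimetric (X : Type) (D : set (X -> X -> R)) : Prop :=
  (forall d, D d -> pseudometric d) /\
  (forall x y, x <> y -> exists2 d, D d & 0 < d x y).

Definition all_continuous (T : topologicalType) (D : set (T -> T -> R)) : Prop :=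
  forall d, D d -> continuous (fun z : T * T => d z.1 z.2).

(* The last conjunct ranges over all topologies [S] on the set underlying [X]
   (not just the one [X] carries), so the last two conjuncts say that the
   topology of [X] is the smallest one making every [d] in [D] continuous. *)
Definition admissible (X : topologicalType) (D : set (X -> X -> R)) : Prop :=
  [/\ multimetric D,
      all_continuous D
    & forall S : Topological.axioms_ X,
        let XS := Topological.Pack S in
        @all_continuous XS D -> forall U : set X, @open X U -> @open XS U].

Definition cauchy_for (X : Type) (D : set (X -> X -> R)) (u : nat -> X) : Prop :=
  forall d, D d -> forall e : R, 0 < e ->
    exists N : nat, forall m n : nat,
      (N <= m)%N -> (N <= n)%N -> d (u m) (u n) < e.

Definition sequentially_complete (X : topologicalType)
    (D : set (X -> X -> R)) : Prop :=
  forall u : nat -> X, cauchy_for D u -> exists x : X, u @ \oo --> x.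

End Multimetrics.

Definition tychonoff_space (X : topologicalType) : Prop :=
  completely_regular_space X /\ hausdorff_space X.

Definition function_system (X : topologicalType) (F : set (X -> X)) : Prop :=
  [/\ finite_set F, F !=set0 & forall f, F f -> continuous f].

Fixpoint system_pow (X : Type) (F : set (X -> X)) (n : nat) : set (X -> X) :=
  if n is m.+1 then [set f \o g | f in F & g in system_pow F m]
  else [set id].

Definition system_image (X : Type) (F : set (X -> X)) (A : set X) : set X :=
  \bigcup_(f in F) (f @` A).

Definition compact_dominating (X : topologicalType) (F : set (X -> X)) : Prop :=
  forall C : set X, compact C ->
    exists K : set X, [/\ compact K, C `<=` K & system_image F K `<=` K].

Section Contractions.
Context {R : realType}.

(* The function d\omega_G; only its restriction to [0, +oo] is meaningful
   (for negative [t] it is the supremum of the empty set). *)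
Definition modulus (X : Type) (d : X -> X -> R) (G : set (X -> X))
    (t : \bar R) : \bar R :=
  ereal_sup [set s | exists g x y,
    [/\ G g, ((d x y)%:E <= t)%E & s = (d (g x) (g y))%:E]].

Definition krasnoselskii_contracting (X : Type) (F : set (X -> X))
    (D : set (X -> X -> R)) : Prop :=
  forall d, D d -> forall a b : R, 0 < a -> a < b ->
    (ereal_sup [set modulus d F t%:E * (t^-1)%R%:E
       | t in [set t : R | (a <= t <= b)%R]]
     < 1)%E.

Definition matkowski_contracting (X : Type) (F : set (X -> X))
    (D : set (X -> X -> R)) : Prop :=
  forall d, D d -> forall t : R, 0 < t ->
    (fun n : nat => iter n (modulus d F) t%:E) @ \oo --> (0 : \bar R)%E.

Definition eventually_contracting (X : Type) (F : set (X -> X))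
    (D : set (X -> X -> R)) : Prop :=
  forall d, D d -> forall t : R, 0 < t ->
    (fun n : nat => modulus d (system_pow F n) t%:E) @ \oo --> (0 : \bar R)%E.

End Contractions.

(* Main.v *)
Require Import Defs.
From HB Require Import structures.
From mathcomp Require Import all_boot all_order all_algebra.
From mathcomp Require Import all_classical all_reals all_analysis.
From mathcomp Require Import ring lra.
Import Order.TTheory GRing.Theory Num.Theory.
Import numFieldNormedType.Exports.

(** Two of the implications keep the multimetric.  If [d omega_F (s) <= l * s]
    with [l < 1] for all [s] between [e] and [t], then the iterates of
    [d omega_F] at [t] are bounded by [max e (l ^ n * t)], so a Krasnoselskii
    contracting system is Matkowski contracting
    ([krasnoselskii_matkowski]); and [d omega_{F^n} <= (d omega_F)^n], so a
    Matkowski contracting system is eventually contracting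
    ([matkowski_eventually]).

    To return from eventually to Krasnoselskii contracting, each [d] in [D] is
    replaced by the pseudometric
      [d' x y = sup_n sup_(g in F^n) w_n * d (g x) (g y)],
    where the weights [w_n] increase strictly from [1] towards [2].  A map [f] of
    the system shifts the orbit by one step, so it multiplies the [n]-th term
    by at most [w_n / w_(n+1) < 1].  These ratios tend to [1], but on a range
    [a <= t <= b] only finitely many of them matter: by eventual contraction
    there is an [N] such that all the terms with [n > N] are at most [a / 2]
    as soon as [d x y <= b].  Hence [F] is Krasnoselskii contracting for [d']
    ([orbit_metric_contracting]).  The same cutting of the supremum into
    finitely many terms and a uniformly small tail shows that [d'] is finite
    ([has_ubound_orbit_values]) and continuous ([orbit_metric_continuous]).

    Since [d <= d'], every topology in which [d'] is continuous makes [d]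
    continuous, and every [d']-Cauchy sequence is [d]-Cauchy.  So the family of
    all the [d'] is again admissible, is sequentially complete if [D] is, and
    is no larger than [D] because it is an image of it. *)

Set Implicit Arguments.
Unset Strict Implicit.
Unset Printing Implicit Defensive.

Local Open Scope classical_set_scope.
Local Open Scope card_scope.

Lemma filter_forall_finite (I T : Type) (A : set I) (P : I -> set T)
    (G : set_system T) : Filter G -> finite_set A ->
  (forall a, A a -> G (P a)) -> G [set y | forall a, A a -> P a y].
Proof.
move=> FG /(@finite_fsetP {classic I}) [B AB] GP.
have := @filter_bigI T {classic I} B P G FG.
move=> GB; apply: filterS (GB _) => [y Py a|a aB].
  by rewrite AB => /Py.
by apply: GP; rewrite AB.
Qed.

Section Contraction.
Local Open Scope ring_scope.
Context {R : realType}.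

Lemma cvge0_nneg (u : nat -> \bar R) : (forall n, (0 <= u n)%E) ->
  u @ \oo --> (0 : \bar R)%E <->
  (forall e : R, 0 < e -> \forall n \near \oo, (u n <= e%:E)%E).
Proof.
move=> u0; split=> [/fine_cvgP[ufin /cvgrPdist_le ucvg] e e0|small].
  near=> n.
  have unfin : u n \is a fin_num by near: n.
  have : `|0 - fine (u n)| <= e by near: n; exact: ucvg.
  by rewrite sub0r normrN ger0_norm ?fine_ge0// -lee_fin fineK.
apply/fine_cvgP; split.
  near=> n; rewrite ge0_fin_numE//; apply: (@le_lt_trans _ _ 1%:E).
    by near: n; exact: small.
  exact: ltry.
apply/cvgrPdist_le => e e0; near=> n.
have une : (u n <= e%:E)%E by near: n; exact: small.
rewrite sub0r normrN ger0_norm ?fine_ge0// -lee_fin fineK//.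
by rewrite ge0_fin_numE// (le_lt_trans une)// ltry.
Unshelve. all: by end_near. Qed.

(** * Moduli and their iterates *)

Section Modulus.
Context {X : Type}.
Implicit Types (d : X -> X -> R) (G : set (X -> X)).

Lemma le_modulus_of d G (t : \bar R) g x y :
  G g -> ((d x y)%:E <= t)%E -> ((d (g x) (g y))%:E <= modulus d G t)%E.
Proof. by move=> Gg dt; apply: ereal_sup_ubound; exists g, x, y. Qed.

Lemma modulus_leP d G (t s : \bar R) :
  (modulus d G t <= s)%E <->
  forall g x y, G g -> ((d x y)%:E <= t)%E -> ((d (g x) (g y))%:E <= s)%E.
Proof.
split=> [ms g x y Gg dt|H].
  by apply: (le_trans _ ms); exact: le_modulus_of.
by apply: ge_ereal_sup => _ [g [x [y [Gg dt ->]]]]; exact: H.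
Qed.

Lemma modulus_homo d G (s t : \bar R) :
  (s <= t)%E -> (modulus d G s <= modulus d G t)%E.
Proof.
move=> st; apply/modulus_leP => g x y Gg ds.
by apply: le_modulus_of => //; exact: le_trans ds st.
Qed.

Lemma modulus_ge0 d G (t : \bar R) (x : X) : pseudometric d -> G !=set0 ->
  (0 <= t)%E -> (0 <= modulus d G t)%E.
Proof.
move=> [d0 dxx _ _] [g Gg] t0; apply: (@le_trans _ _ (d (g x) (g x))%:E).
  by rewrite lee_fin.
by apply: le_modulus_of; rewrite ?dxx.
Qed.

Lemma iter_modulus_ge0 d G (t : R) n (x : X) : pseudometric d -> G !=set0 ->
  0 < t -> (0 <= iter n (modulus d G) t%:E)%E.
Proof.
move=> pd G0 t0; elim: n => [|n IH]; first by rewrite lee_fin ltW.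
exact: (modulus_ge0 x).
Qed.

Lemma system_pow_neq0 G n : G !=set0 -> system_pow G n !=set0.
Proof.
move=> [f Gf]; elim: n => [|n [g Gg]]; first by exists id.
by exists (f \o g), f => //; exists g.
Qed.

Lemma finite_system_pow G n : finite_set G -> finite_set (system_pow G n).
Proof.
by move=> fG; elim: n => [|n IH]; [exact: finite_set1|exact: finite_image2].
Qed.

(** [system_pow] composes new maps on the left; the orbit pseudometric needs
    them on the right, where [f] acts before the rest of the orbit. *)
Lemma system_powSr G n g f :
  system_pow G n g -> G f -> system_pow G n.+1 (g \o f).
Proof.
move=> + Gf; elim: n g => [_ ->|n IH _ [h Gh [g Gg <-]]].
  by exists f => //; exists id.
by exists h => //; exists (g \o f) => //; exact: IH.
Qed.

Lemma modulus_system_pow d G (t : \bar R) n :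
  (modulus d (system_pow G n) t <= iter n (modulus d G) t)%E.
Proof.
elim: n => [|n IH]; apply/modulus_leP => /=.
  by move=> _ x y ->.
move=> _ x y [f Gf [g Gg <-]] dt.
apply: (@le_modulus_of d G _ f (g x) (g y)) => //.
by apply: (le_trans _ IH); exact: le_modulus_of.
Qed.

(** On a compact range of [s] the bound [modulus d G s <= l * s] holds with one
    [l < 1], so the iterates decrease geometrically until they fall below the
    lower end [e] of the range; by monotonicity of the modulus they cannot
    leave [[0, e]] afterwards. *)
Lemma krasnoselskii_matkowski G (D : set (X -> X -> R)) (x : X) :
  (forall d, D d -> pseudometric d) -> G !=set0 ->
  krasnoselskii_contracting G D -> matkowski_contracting G D.
Proof.
move=> pD G0 kD d Dd t t0; apply/cvge0_nneg => [n|e0 e0_gt0].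
  exact: (iter_modulus_ge0 _ x (pD _ Dd)).
(* The lower end of the range has to lie strictly below [t]. *)
pose e := Num.min e0 (t / 2).
have e_gt0 : 0 < e by rewrite lt_min e0_gt0 divr_gt0.
have et : e < t by rewrite gt_min; apply/orP; right; lra.
have ee0 : e <= e0 by rewrite ge_min lexx.
have [l [l0 l1 ml]] : exists l : R, [/\ 0 <= l, l < 1 &
    forall s, e <= s <= t -> (modulus d G s%:E <= (l * s)%:E)%E].
  have := kD d Dd e t e_gt0 et; set S := ereal_sup _ => S1.
  have leS s : e <= s <= t -> (modulus d G s%:E * s^-1%:E <= S)%E.
    by move=> ?; apply: ereal_sup_ubound; exists s.
  have S0 : (0 <= S)%E.
    apply: (le_trans _ (leS e _)); last by rewrite lexx ltW.
    apply: mule_ge0; last by rewrite lee_fin invr_ge0 ltW.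
    by apply: (modulus_ge0 x) => //; [exact: pD|rewrite lee_fin ltW].
  have Sfin : S \is a fin_num by rewrite ge0_fin_numE// (lt_trans S1)// ltry.
  exists (fine S); split; first exact: fine_ge0.
    by rewrite -lte_fin fineK.
  move=> s est; have s0 : 0 < s by case/andP: est => /(lt_le_trans e_gt0).
  by rewrite EFinM fineK// -lee_pdivrMr// leS.
have iterl n : (iter n (modulus d G) t%:E <= (Num.max e (l ^+ n * t))%:E)%E.
  elim: n => [|n IH]; first by rewrite lee_fin expr0 mul1r le_max lexx orbT.
  rewrite iterS (le_trans (modulus_homo _ _ IH))//.
  apply: le_trans (ml _ _) _.
    rewrite le_max lexx/= ge_max (ltW et)/=.
    by rewrite ler_piMl ?(ltW t0)// exprn_ile1// ltW.
  rewrite lee_fin maxr_pMr// exprS mulrA ge_max !le_max lexx orbT andbT.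
  by rewrite ler_piMl ?(ltW l1)// ltW.
have small : \forall n \near \oo, `|0 - l ^+ n| <= e / t.
  have /cvgrPdist_le : (GRing.exp l : nat -> R) @ \oo --> (0 : R).
    by apply: cvg_expr; rewrite ger0_norm.
  by apply; exact: divr_gt0.
near=> n; rewrite (le_trans (iterl n))// lee_fin (le_trans _ ee0)//.
rewrite ge_max lexx/= -ler_pdivlMr//.
have : `|0 - l ^+ n| <= e / t by near: n.
by rewrite sub0r normrN ger0_norm// exprn_ge0.
Unshelve. all: by end_near. Qed.

Lemma matkowski_eventually G (D : set (X -> X -> R)) (x : X) :
  (forall d, D d -> pseudometric d) -> G !=set0 ->
  matkowski_contracting G D -> eventually_contracting G D.
Proof.
move=> pD G0 mD d Dd t t0; apply: squeeze_cvge; last exact: (mD d Dd t t0).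
  apply: nearW => n; apply/andP; split; last exact: modulus_system_pow.
  apply: (modulus_ge0 x); [exact: pD|exact: system_pow_neq0|].
  by rewrite lee_fin ltW.
exact: cvg_cst.
Qed.

(** Eventual contraction for a single pseudometric, stated with real numbers
    only: this form serves to cut off the tail of an orbit. *)
Definition uniformly_shrinking G d := forall t e : R, 0 < t -> 0 < e ->
  exists N, forall n g x y,
    (N <= n)%N -> system_pow G n g -> d x y <= t -> d (g x) (g y) <= e.

Lemma eventually_contracting_shrinking G (D : set (X -> X -> R)) (x : X) d :
  (forall d, D d -> pseudometric d) -> G !=set0 ->
  eventually_contracting G D -> D d -> uniformly_shrinking G d.
Proof.
move=> pD G0 eD Dd t e t0 e0.
have m0 n : (0 <= modulus d (system_pow G n) t%:E)%E.
  apply: (modulus_ge0 x); [exact: pD|exact: system_pow_neq0|].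
  by rewrite lee_fin ltW.
have /(cvge0_nneg m0)/(_ e e0) [N _ HN] := eD d Dd t t0.
exists N => n g y z /HN /= /modulus_leP H Gg dt.
by rewrite -lee_fin; exact: H.
Qed.

End Modulus.

(** * The weighted orbit pseudometric *)

Section OrbitMetric.
Context {X : Type} (F : set (X -> X)) (d : X -> X -> R).
Hypothesis pd : pseudometric d.
Hypothesis finF : finite_set F.
Hypothesis shF : uniformly_shrinking F d.

(** These weights increase from [1] towards [2], and their ratios
    [weight n / weight n.+1 = 1 - (n + 2) ^ -2] increase too, so that the
    [N]-th ratio bounds all the previous ones. *)
Definition weight (n : nat) : R := n.+1%:R * 2 / n.+2%:R.

Lemma weight0 : weight 0 = 1.
Proof. by rewrite /weight; field. Qed.

Lemma weight_ge0 n : 0 <= weight n.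
Proof. by rewrite /weight divr_ge0// mulr_ge0. Qed.

Lemma weight_le2 n : weight n <= 2.
Proof. by rewrite /weight ler_pdivrMr// mulrC ler_pM2l// ler_nat. Qed.

Lemma weight_ratio n N : (n <= N)%N ->
  weight n <= (1 - N.+2%:R^-1 ^+ 2) * weight n.+1.
Proof.
move=> nN; have -> : weight n = (1 - n.+2%:R^-1 ^+ 2) * weight n.+1.
  have n0 : 0 <= n%:R :> R by [].
  rewrite /weight -[in n.+3%:R]addn3 -[in n.+2%:R]addn2 -[in n.+1%:R]addn1.
  rewrite !natrD; field; apply/andP; split; apply: lt0r_neq0; lra.
apply: ler_wpM2r; first exact: weight_ge0.
rewrite lerD2l lerN2 lerXn2r ?nnegrE ?invr_ge0//.
by rewrite lef_pV2 ?posrE// ler_nat.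
Qed.

Definition orbit_values x y : set R :=
  [set s | exists n g,
     system_pow F n g /\ s = weight n * d (g x) (g y)].

Definition orbit_metric x y : R := sup (orbit_values x y).

(** All maps of high order bring [x] and [y] within distance [1] of each other,
    and only finitely many maps have lower order. *)
Lemma has_ubound_orbit_values x y : has_ubound (orbit_values x y).
Proof.
have [d0 _ _ _] := pd.
(* The radius must be positive, and [d x y] may vanish. *)
have [|N HN] := @shF (d x y + 1) 1 _ ltr01.
  by rewrite ltr_wpDl.
(* A bound common to finitely many maps, found as a number near infinity. *)
have : \forall M \near +oo, forall g, (\bigcup_(n in `I_N) system_pow F n) g ->
    d (g x) (g y) <= M.
  apply: filter_forall_finite.
    by apply: bigcup_finite => // n _; exact: finite_system_pow.
  by move=> g _; apply: nbhs_pinfty_ge; exact: num_real.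
move=> small; have /filter_ex [M [M1 HM]] :
    \forall M \near +oo, 1 <= M /\
      forall g, (\bigcup_(n in `I_N) system_pow F n) g -> d (g x) (g y) <= M.
  by apply: filterI => //; apply: nbhs_pinfty_ge; exact: num_real.
exists (2 * M) => _ [n [g [Gg ->]]].
apply: ler_pM => //; [exact: weight_ge0|exact: weight_le2|].
have [nN|Nn] := ltnP n N; first by apply: HM; exists n.
by apply: (le_trans _ M1); apply: (HN n g) => //; rewrite lerDl.
Qed.

Lemma orbit_metric_ub n g x y : system_pow F n g ->
  weight n * d (g x) (g y) <= orbit_metric x y.
Proof.
move=> Gg; apply: ub_le_sup; first exact: has_ubound_orbit_values.
by exists n, g.
Qed.

Lemma orbit_metric_le x y e :
  (forall n g, system_pow F n g -> weight n * d (g x) (g y) <= e) ->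
  orbit_metric x y <= e.
Proof.
move=> H; apply: ge_sup; last by move=> _ [n [g [/H ? ->]]].
by exists (weight 0 * d x y), 0%N, id.
Qed.

Lemma le_orbit_metric x y : d x y <= orbit_metric x y.
Proof.
by have := @orbit_metric_ub 0 id x y erefl; rewrite weight0 mul1r.
Qed.

Lemma pseudometric_orbit_metric : pseudometric orbit_metric.
Proof.
have [d0 dxx dC dT] := pd; have om0 x y : 0 <= orbit_metric x y.
  exact: le_trans (le_orbit_metric x y).
split=> // [x|x y|x y z].
- apply/eqP; rewrite eq_le om0 andbT; apply: orbit_metric_le => n g _.
  by rewrite dxx mulr0.
- congr sup; apply/seteqP.
  by split=> _ [n [g [Gg ->]]]; exists n, g; rewrite dC.
- apply: orbit_metric_le => n g Gg.
  apply: le_trans (lerD (orbit_metric_ub x y Gg) (orbit_metric_ub y z Gg)).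
  by rewrite -mulrDr ler_wpM2l ?weight_ge0.
Qed.

(** A term of order [n <= N] shrinks by the ratio of consecutive weights, at
    most [l]; beyond [N] a term is at most [2 * (a / 4) = a / 2], and
    [a / 2 <= l * t] because [1 / 2 <= l]. *)
Lemma orbit_metric_contracting a b : 0 < a -> a < b ->
  (ereal_sup [set modulus orbit_metric F t%:E * t^-1%:E
     | t in [set t : R | (a <= t <= b)%R]] < 1)%E.
Proof.
move=> a0 ab; have a40 : 0 < a / 4 by lra.
have [N HN] := shF (lt_trans a0 ab) a40.
pose l : R := 1 - N.+2%:R^-1 ^+ 2.
have l1 : l < 1 by rewrite /l gtrBl exprn_gt0.
have l2 : 2^-1 <= l.
  have : (N.+2%:R^-1 : R) ^+ 2 <= 2^-1 ^+ 2.
    by rewrite lerXn2r ?nnegrE ?invr_ge0// lef_pV2 ?posrE// ler_nat.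
  by rewrite /l; move: (_ ^+ 2) => v; rewrite expr2; lra.
apply: (@le_lt_trans _ _ l%:E) => //.
apply: ge_ereal_sup => _ [t /= /andP[at_ tb] <-].
have t0 : 0 < t by exact: lt_le_trans at_.
rewrite lee_pdivrMr// -EFinM.
apply/modulus_leP => f x y Ff; rewrite !lee_fin => xyt.
apply: orbit_metric_le => n g Gg.
have Ggf : system_pow F n.+1 (g \o f) by exact: system_powSr.
have [d0 _ _ _] := pd.
have [nN|Nn] := leqP n N.
  apply: le_trans (_ : l * (weight n.+1 * d (g (f x)) (g (f y))) <= _).
    by rewrite mulrA ler_wpM2r// weight_ratio.
  rewrite ler_wpM2l//; first lra.
  exact: le_trans (orbit_metric_ub x y Ggf) xyt.
apply: (@le_trans _ _ (2 * (a / 4))); last nra.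
apply: ler_pM => //; [exact: weight_ge0|exact: weight_le2|].
apply: (HN n.+1 (g \o f)) => //; first by rewrite ltnW// ltnW.
exact: le_trans (le_trans (le_orbit_metric x y) xyt) tb.
Qed.

End OrbitMetric.

(** * Continuity and admissibility *)

Section Continuity.
Context {T : topologicalType}.
Implicit Types d : T -> T -> R.

(** By the triangle inequality, continuity of a pseudometric on the product
    reduces to continuity of [d x] at [x] for each [x]. *)
Lemma pseudometric_continuousP d : pseudometric d ->
  continuous (fun z : T * T => d z.1 z.2) <->
  forall x e, 0 < e -> \forall y \near x, d x y <= e.
Proof.
move=> [d0 dxx dC dT]; split=> [cd x e e0|small [x y]].
  have cx : (fun y => d x y) @ x --> d x x.
    by apply: continuous2_cvg; [exact: (cd (x, x))|exact: cvg_cst|exact: cvg_id].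
  move/cvgrPdist_le : cx => /(_ e e0); apply: filterS => y.
  by rewrite dxx sub0r normrN ger0_norm.
apply/cvgrPdist_le => e e0; have e20 : 0 < e / 2 by rewrite divr_gt0.
near=> z.
have xz : d x z.1 <= e / 2.
  by near: z; exact: (cvg_fst (small x _ e20)).
have yz : d y z.2 <= e / 2.
  by near: z; exact: (cvg_snd (small y _ e20)).
rewrite /= ler_distlC; apply/andP; split.
  have := dT x z.1 y; have := dT z.1 z.2 y; rewrite (dC z.2 y); lra.
have := dT z.1 x z.2; have := dT x y z.2; rewrite (dC z.1 x); lra.
Unshelve. all: by end_near. Qed.

Lemma le_pseudometric_continuous d d' :
  pseudometric d -> pseudometric d' -> (forall x y, d x y <= d' x y) ->
  continuous (fun z : T * T => d' z.1 z.2) ->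
  continuous (fun z : T * T => d z.1 z.2).
Proof.
move=> pd pd' dd' /(pseudometric_continuousP pd') cd'.
apply/(pseudometric_continuousP pd) => x e e0.
by apply: filterS (cd' x e e0) => y; exact: le_trans.
Qed.

Lemma continuous_system_pow (F : set (T -> T)) n g :
  (forall f, F f -> continuous f) -> system_pow F n g -> continuous g.
Proof.
move=> cF; elim: n g => [_ -> x|n IH _ [f Ff [g Gg <-]] x]; first exact: cvg_id.
by apply: continuous_comp; [exact: IH|exact: cF].
Qed.

(** If [d x y <= 1] then the terms of order at least [N] are uniformly small;
    the finitely many others are small for [y] close to [x] by continuity of
    the maps and of [d]. *)
Lemma orbit_metric_continuous (F : set (T -> T)) d :
  pseudometric d -> function_system F -> uniformly_shrinking F d ->
  continuous (fun z : T * T => d z.1 z.2) ->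
  continuous (fun z : T * T => orbit_metric F d z.1 z.2).
Proof.
move=> pd [finF F0 cF] shF /(pseudometric_continuousP pd) cd.
apply/pseudometric_continuousP; first exact: pseudometric_orbit_metric.
move=> x e e0; have e20 : 0 < e / 2 by rewrite divr_gt0.
have [N HN] := shF 1 (e / 2) ltr01 e20.
have small : \forall y \near x,
    forall g, (\bigcup_(n in `I_N) system_pow F n) g -> d (g x) (g y) <= e / 2.
  apply: (@filter_forall_finite _ _ _ (fun g y => d (g x) (g y) <= e / 2)).
    by apply: bigcup_finite => // n _; exact: finite_system_pow.
  by move=> g [n _ Gg]; exact: (continuous_system_pow cF Gg (cd _ _ e20)).
near=> y.
have dxy : d x y <= 1 by near: y; exact: cd.
have Hy : forall g, (\bigcup_(n in `I_N) system_pow F n) g ->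
  d (g x) (g y) <= e / 2 by near: y.
apply: orbit_metric_le => n g Gg; have [d0 _ _ _] := pd.
have -> : e = 2 * (e / 2) by field.
apply: ler_pM => //; [exact: weight_ge0|exact: weight_le2|].
have [nN|Nn] := ltnP n N; first by apply: Hy; exists n.
exact: (HN n).
Unshelve. all: by end_near. Qed.

End Continuity.

(** Replacing each [d] by a larger continuous pseudometric can neither change
    the canonical topology nor destroy sequential completeness. *)
Lemma eventually_krasnoselskii (T : topologicalType) (F : set (T -> T))
    (D : set (T -> T -> R)) :
  [set: T] !=set0 -> function_system F -> admissible D ->
  eventually_contracting F D ->
  let D' := [set orbit_metric F d | d in D] in
  [/\ admissible D', krasnoselskii_contracting F D'
    & sequentially_complete D -> sequentially_complete D'].
Proof.
move=> [x0 _] sysF [[pD sepD] cD minD] eD D'.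
have [finF F0 cF] := sysF.
have shD d : D d -> uniformly_shrinking F d.
  by move=> Dd; exact: (eventually_contracting_shrinking x0 pD F0 eD Dd).
have leD d x y : D d -> d x y <= orbit_metric F d x y.
  by move=> Dd; apply: le_orbit_metric => //; [exact: pD|exact: shD].
have pD' d : D d -> pseudometric (orbit_metric F d).
  by move=> Dd; apply: pseudometric_orbit_metric => //; [exact: pD|exact: shD].
split.
- split.
  + split=> [_ [d Dd <-]|x y /sepD[d Dd dxy]]; first exact: pD'.
    exists (orbit_metric F d); first by exists d.
    exact: lt_le_trans dxy (leD _ _ _ Dd).
  + move=> _ [d Dd <-]; apply: orbit_metric_continuous => //.
    * exact: pD.
    * exact: shD.
    * exact: cD.
  + move=> S XS cD'; apply: minD => d Dd.
    apply: (@le_pseudometric_continuous XS d (orbit_metric F d)).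
    * exact: pD.
    * exact: pD'.
    * by move=> x y; exact: leD.
    * by apply: cD'; exists d.
- move=> _ [d Dd <-] a b a0 ab.
  by apply: orbit_metric_contracting => //; [exact: pD|exact: shD].
- move=> scD u cu; apply: scD => d Dd e e0.
  have [|N HN] := cu (orbit_metric F d) _ e e0; first by exists d.
  exists N => m n Nm Nn; exact: le_lt_trans (leD _ _ _ Dd) (HN m n Nm Nn).
Qed.

End Contraction.

Theorem theorem6p12 (R : realType) (K : Type) (hK : [set: K] !=set0)
    (X : topologicalType) (hX : [set: X] !=set0) (tX : tychonoff_space X)
    (F : set (X -> X)) (sysF : function_system F) (domF : compact_dominating F) :
  [<-> exists D : set (X -> X -> R),
         [/\ admissible D, D #<= [set: K] & krasnoselskii_contracting F D];
       exists D : set (X -> X -> R),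
         [/\ admissible D, D #<= [set: K] & matkowski_contracting F D];
       exists D : set (X -> X -> R),
         [/\ admissible D, D #<= [set: K] & eventually_contracting F D]]
  /\
  [<-> exists D : set (X -> X -> R),
         [/\ admissible D, sequentially_complete D, D #<= [set: K]
           & krasnoselskii_contracting F D];
       exists D : set (X -> X -> R),
         [/\ admissible D, sequentially_complete D, D #<= [set: K]
           & matkowski_contracting F D];
       exists D : set (X -> X -> R),
         [/\ admissible D, sequentially_complete D, D #<= [set: K]
           & eventually_contracting F D]].
Proof.
have [x0 _] := hX; have [_ F0 _] := sysF.
split; tfae.
- move=> [D [aD DK kD]]; exists D; split=> //.
  by have [[pD _] _ _] := aD; exact: (krasnoselskii_matkowski x0).
- move=> [D [aD DK mD]]; exists D; split=> //.
  by have [[pD _] _ _] := aD; exact: (matkowski_eventually x0).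
- move=> [D [aD DK eD]].
  have [aD' kD' _] := eventually_krasnoselskii hX sysF aD eD.
  exists [set orbit_metric F d | d in D]; split=> //.
  by apply: card_le_trans DK; exact: card_image_le.
- move=> [D [aD sD DK kD]]; exists D; split=> //.
  by have [[pD _] _ _] := aD; exact: (krasnoselskii_matkowski x0).
- move=> [D [aD sD DK mD]]; exists D; split=> //.
  by have [[pD _] _ _] := aD; exact: (matkowski_eventually x0).
- move=> [D [aD sD DK eD]].
  have [aD' kD' sD'] := eventually_krasnoselskii hX sysF aD eD.
  exists [set orbit_metric F d | d in D]; split=> //; first exact: sD'.
  by apply: card_le_trans DK; exact: card_image_le.
Qed.
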